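(* Let $D\subset\mathbb{R}^d$, $U\subset\mathbb{R}^n$ be bounded domains, let $X$, $Y$ be separable Banach spaces with continuous embeddings $X\hookrightarrow L^2(D)$, $Y\hookrightarrow L^2(U)$, let $\mu$ be a Borel probability measure on $X$ with $\int_X\|u\|_X^2\,d\mu(u)<\infty$, let $A\subset X$ be a Borel set consisting of continuous functions with $\mu(A)=1$, and let $\mathcal{G}:X\to Y$ be a Borel measurable mapping with $\int_X\|\mathcal{G}(u)\|_{L^2(U)}^2\,d\mu(u)<\infty$. Let the nonlinear operator $\mathcal{G}:A\subset X\to Y$ be $\alpha$-Hölder continuous (or Lipschitz continuous if $\alpha=1$). Choose an arbitrary encoder $\mathcal{E}:C(D)\to\mathbb{R}^m$, approximator $\mathcal{A}:\mathbb{R}^m\to\mathbb{R}^p$ and an arbitrary reconstruction $\mathcal{R}:\mathbb{R}^p\to L^2(U)$ of the form $\mathcal{R}(\alpha_1,\dots,\alpha_p)=\tau_0+\sum_{k=1}^p\alpha_k\tau_k$. Then the error $$\widehat{\mathscr{E}}=\left(\int_X\|\mathcal{G}(u)-\mathcal{N}(u)\|_{L^2(U)}^2\,d\mu(u)\right)^{1/2}$$ associated with the DeepONet $\mathcal{N}=\mathcal{R}\circ\mathcal{A}\circ\mathcal{E}$ satisfies the upper bound $$\widehat{\mathscr{E}}\le \mathrm{Lip}_\alpha(\mathcal{G})\,\mathrm{Lip}(\mathcal{R}\circ\mathcal{P})\,(\widehat{\mathscr{E}}_{\mathcal{E}})^\alpha+\mathrm{Lip}(\mathcal{R})\,\widehat{\mathscr{E}}_{\mathcal{A}}+\widehat{\mathscr{E}}_{\mathcal{R}},$$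 where the encoding, approximation and reconstruction errors $\widehat{\mathscr{E}}_{\mathcal{E}}$, $\widehat{\mathscr{E}}_{\mathcal{A}}$, $\widehat{\mathscr{E}}_{\mathcal{R}}$ are formed with given choices of a decoder $\mathcal{D}$ for $\mathcal{E}$ and a projector $\mathcal{P}$ for $\mathcal{R}$.
   Context: Encoder: $\mathcal{E}(u)=(u(x_1),\dots,u(x_m))$ for given sensor points $x_j\in D$. Approximator: a ReLU neural network $\mathcal{A}:\mathbb{R}^m\to\mathbb{R}^p$. In the reconstruction, $\tau_0,\dots,\tau_p$ are the components of a ReLU neural network (trunk net) $\mathbb{R}^n\to\mathbb{R}^{p+1}$. Decoder and projector: the decoder $\mathcal{D}:\mathbb{R}^m\to X$ and the projector $\mathcal{P}:L^2(U)\to\mathbb{R}^p$ are (not necessarily unique, chosen) approximate inverses of $\mathcal{E}$ and $\mathcal{R}$, required to satisfy exactly $\mathcal{E}\circ\mathcal{D}=\mathrm{Id}$ on $\mathbb{R}^m$ and $\mathcal{P}\circ\mathcal{R}=\mathrm{Id}$ on $\mathbb{R}^p$ (while $\mathcal{D}\circ\mathcal{E}\approx\mathrm{Id}$ and $\mathcal{R}\circ\mathcal{P}\approx\mathrm{Id}$ only approximately). Errors, with $\#$ denoting push-forward of measures: $\widehat{\mathscr{E}}_{\mathcal{E}}=\left(\int_X\|\mathcal{D}\circ\mathcal{E}(u)-u\|_X^2\,d\mu(u)\right)^{1/2}$, $\widehat{\mathscr{E}}_{\mathcal{A}}=\left(\int_{\mathbb{R}^m}\|\mathcal{A}(\mathbf{u})-\mathcal{P}\circ\mathcal{G}\circ\mathcal{D}(\mathbf{u})\|_{\ell^2(\mathbb{R}^p)}^2\,d(\mathcal{E}_\#\mu)(\mathbf{u})\right)^{1/2}$,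 $\widehat{\mathscr{E}}_{\mathcal{R}}=\left(\int_{L^2(U)}\|\mathcal{R}\circ\mathcal{P}(v)-v\|_{L^2(U)}^2\,d(\mathcal{G}_\#\mu)(v)\right)^{1/2}$. For a mapping $\mathcal{F}:X\to Y$ between Banach spaces, $\mathrm{Lip}_\alpha(\mathcal{F})=\sup_{u\neq u'}\|\mathcal{F}(u)-\mathcal{F}(u')\|_Y/\|u-u'\|_X^\alpha$ and $\mathrm{Lip}(\mathcal{F})=\mathrm{Lip}_1(\mathcal{F})$. The spaces $\mathbb{R}^m,\mathbb{R}^p$ carry the $\ell^2$-norm and $L^2(U)$ its usual norm. $X$ and $Y$ are identified with subsets of $L^2(D)$ and $L^2(U)$.
   Formalization: Lip_α(G) is measured in the norm of L²(U) rather than of Y, and its supremum runs over A together with the range of the decoder D; with the Y-norm, or with the supremum over A alone, the bound is false in general. *)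

(* Defs.v *)
From HB Require Import structures.
From mathcomp Require Import all_boot all_order all_algebra.
From mathcomp Require Import all_classical all_reals all_analysis.
From mathcomp Require Import measurable_realfun.
Import Order.TTheory GRing.Theory Num.Theory.
Import numFieldNormedType.Exports.
Set Implicit Arguments.
Unset Strict Implicit.
Unset Printing Implicit Defensive.

Local Open Scope classical_set_scope.
Local Open Scope ring_scope.
Local Open Scope quotient_scope.

Section L2.
Context d (T : measurableType d) (R : realType).
Variable mu : {measure set T -> \bar R}.

Lemma le1_2 : (1 <= 2%:E :> \bar R)%E. Proof. by rewrite lee1n. Qed.

Notation F := (LfunType mu le1_2).

Definition L2_eq (f g : F) : bool := `[< {ae mu, forall x, f x = g x} >].

Let L2_eq_refl : reflexive L2_eq.
Proof. by move=> f; apply/asboolP/aeW. Qed.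

Let L2_eq_sym : symmetric L2_eq.
Proof.
by move=> f g; apply/asboolP/asboolP => h; apply: filterS h => x ->.
Qed.

Let L2_eq_trans : transitive L2_eq.
Proof.
move=> f g h /asboolP gf /asboolP fh; apply/asboolP.
by apply: filterS2 gf fh => x -> ->.
Qed.

Canonical L2_equiv := EquivRel L2_eq L2_eq_refl L2_eq_sym L2_eq_trans.

(* L^2(mu) as the normed space of classes of square-integrable functions modulo
   equality almost everywhere; [LspaceType] carries no vector space structure. *)
Definition L2 : Type := {eq_quot L2_eq}.
HB.instance Definition _ := Choice.on L2.
HB.instance Definition _ := EqQuotient.on L2.

Definition L2_fun (v : L2) : T -> R := repr v : F.

Lemma L2_piP (f g : F) : \pi_L2 f = \pi_L2 g <-> {ae mu, forall x, f x = g x}.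
Proof.
by split=> [/eqP|h]; [|apply/eqP]; rewrite eqmodE /= => //; [move/asboolP|apply/asboolP].
Qed.

Lemma L2_reprK (f : F) : {ae mu, forall x, (repr (\pi_L2 f) : F) x = f x}.
Proof. by apply/L2_piP; rewrite reprK. Qed.

Definition L2_add (u v : L2) : L2 := \pi_L2 ((repr u : F) + repr v).
Definition L2_opp (u : L2) : L2 := \pi_L2 (- (repr u : F)).
Definition L2_zero : L2 := \pi_L2 (0 : F).
Definition L2_scale (a : R) (u : L2) : L2 := \pi_L2 (a *: (repr u : F)).

Let FD (f g : F) x : (f + g) x = f x + g x. Proof. by []. Qed.
Let FN (f : F) x : (- f) x = - f x. Proof. by []. Qed.
Let FZ a (f : F) x : (a *: f) x = a * f x. Proof. by []. Qed.

Let piD f g : \pi_L2 (f + g) = L2_add (\pi f) (\pi g).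
Proof.
by apply/L2_piP; apply: filterS2 (L2_reprK f) (L2_reprK g) => x Ef Eg; rewrite !FD Ef Eg.
Qed.
Let piN f : \pi_L2 (- f) = L2_opp (\pi f).
Proof. by apply/L2_piP; apply: filterS (L2_reprK f) => x Ef; rewrite !FN Ef. Qed.
Let piZ a f : \pi_L2 (a *: f) = L2_scale a (\pi f).
Proof. by apply/L2_piP; apply: filterS (L2_reprK f) => x Ef; rewrite !FZ Ef. Qed.

Let L2_addA : associative L2_add.
Proof. move=> u v w; elim/quotW: u => f; elim/quotW: v => g; elim/quotW: w => h; by rewrite -(piD g h) -(piD f g) -(piD f (g + h)) -(piD (f + g) h) addrA. Qed.
Let L2_addC : commutative L2_add.
Proof. move=> u v; elim/quotW: u => f; elim/quotW: v => g; by rewrite -(piD f g) -(piD g f) addrC. Qed.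
Let L2_add0 : left_id L2_zero L2_add.
Proof. move=> u; elim/quotW: u => f; by rewrite -(piD 0 f) add0r. Qed.
Let L2_addN : left_inverse L2_zero L2_opp L2_add.
Proof. move=> u; elim/quotW: u => f; by rewrite -(piN f) -(piD (- f) f) addNr. Qed.

HB.instance Definition _ := GRing.isZmodule.Build L2 L2_addA L2_addC L2_add0 L2_addN.

Let L2_scaleA a b (v : L2) : L2_scale a (L2_scale b v) = L2_scale (a * b) v.
Proof. by elim/quotW: v => f; rewrite -(piZ b f) -(piZ a (b *: f)) -(piZ (a * b) f) scalerA. Qed.
Let L2_scale1 : left_id 1 L2_scale.
Proof. move=> u; elim/quotW: u => f; by rewrite -(piZ 1 f) scale1r. Qed.
Let L2_scaleDr : right_distributive L2_scale +%R.
Proof.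
move=> a u v; elim/quotW: u => f; elim/quotW: v => g.
by rewrite -(piZ a f) -(piZ a g) -[RHS]piD -[_ + _ in LHS]piD -(piZ a (f + g)) scalerDr.
Qed.
Let L2_scaleDl (v : L2) : {morph L2_scale^~ v : a b / a + b}.
Proof. by move=> a b; elim/quotW: v => f; rewrite -(piZ a f) -(piZ b f) -[RHS]piD -(piZ (a + b) f) scalerDl. Qed.

HB.instance Definition _ := GRing.Zmodule_isLmodule.Build R L2
  L2_scaleA L2_scale1 L2_scaleDr L2_scaleDl.

Definition L2_norm (v : L2) : R := fine ('N[mu]_2%:E [EFin \o L2_fun v])%E.

Let nm (f : F) : R := fine ('N[mu]_2%:E [EFin \o f])%E.

Let mpow (f : F) : measurable_fun setT (fun x => `|(EFin \o f) x| `^ 2)%E.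
Proof.
apply: (@measurableT_comp _ _ _ _ _ _ (@poweR R ^~ 2)).
  exact: measurable_poweR.
by apply: measurableT_comp => //; apply/measurable_EFinP.
Qed.

Let normpi (f : F) : L2_norm (\pi f) = nm f.
Proof.
rewrite /L2_norm /nm /L2_fun unlock; congr (fine (_ `^ _)%E).
apply: ae_eq_integral; [by []|exact: mpow|exact: mpow|].
by apply: filterS (L2_reprK f) => x /= ->.
Qed.

Let L2_normD (u v : L2) : L2_norm (u + v) <= L2_norm u + L2_norm v.
Proof.
elim/quotW: u => f; elim/quotW: v => g.
by rewrite -[_ + _ in leLHS]piD !normpi; exact: ler_LnormD.
Qed.
Let L2_normZ a (v : L2) : L2_norm (a *: v) = `|a| * L2_norm v.
Proof.
elim/quotW: v => f; rewrite -[_ *: _]piZ !normpi.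
by apply/EFin_inj; rewrite EFinM !finite_norm_fine LnormZ.
Qed.
Let L2_norm0_eq0 (v : L2) : L2_norm v = 0 -> v = 0.
Proof.
elim/quotW: v => f; rewrite normpi => /fine_Lnormr_eq0 h.
by apply/L2_piP; apply: filterS h => x /(_ I).
Qed.

HB.instance Definition _ :=
  Lmodule_isNormed.Build R L2 L2_normD L2_normZ L2_norm0_eq0.

Lemma L2_normE (v : L2) : `|v| = fine ('N[mu]_2%:E [EFin \o L2_fun v])%E.
Proof. by []. Qed.

End L2.

Section Borel.
Context (R : realType).

(* The type [V] with its Borel sigma-algebra. *)
Definition borel (V : normedModType R) := g_sigma_algebraType (@open V).

Lemma open_borel (V : normedModType R) (O : set V) :
  open O -> measurable (O : set (borel V)).
Proof. exact: sub_sigma_algebra. Qed.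

Definition row_cons n (z : borel 'rV[R]_n * measurableTypeR R) :
  borel 'rV[R]_n.+1 := row_mx (z.2%:M : 'rV[R]_1) (z.1 : 'rV[R]_n).

Let row_cons0 n z : @row_cons n z ord0 ord0 = z.2.
Proof.
have -> : ord0 = @lshift 1 n ord0 by apply: val_inj.
by apply: etrans (@row_mxEl _ 1 1 n _ _ _ _) _; rewrite mxE.
Qed.

Let row_consS n z j : @row_cons n z ord0 (lift ord0 j) = z.1 ord0 j.
Proof.
have -> : lift ord0 j = @rshift 1 n j by apply: val_inj.
exact: (@row_mxEr _ 1 1 n).
Qed.

Lemma measurable_row_cons n : measurable_fun setT (@row_cons n).
Proof.
pose B (q : 'rV[rat]_n.+1 * rat) : set 'rV[R]_n.+1 :=
  ball (map_mx ratr q.1 : 'rV[R]_n.+1) (ratr q.2).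
have mB q : measurable (@row_cons n @^-1` B q).
  have [q0|q0] := ltP 0 (ratr q.2 : R); last first.
    rewrite (_ : _ @^-1` _ = set0)// -subset0 => z [].
    by rewrite ltNge q0.
  rewrite (_ : _ @^-1` _ =
      (ball (\row_j ratr (q.1 ord0 (lift ord0 j)) : 'rV[R]_n) (ratr q.2)) `*`
      (ball (ratr (q.1 ord0 ord0) : R) (ratr q.2))); last first.
    apply/seteqP; split=> [z [_ zq]|z [[_ z1] z2]].
      split; first split=> // i j.
        by have := zq ord0 (lift ord0 j); rewrite row_consS !mxE [i]ord1.
      by have := zq ord0 ord0; rewrite row_cons0 !mxE.
    split=> // i j; rewrite [i]ord1 mxE.
    have [k ->|->] := unliftP ord0 j; last by rewrite row_cons0.
    by have := z1 ord0 k; rewrite row_consS mxE.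
  apply: measurableX; first by apply: open_borel; exact: ball_open.
  by apply: open_measurable; exact: ball_open.
apply: (@measurability _ _ _ (borel 'rV[R]_n.+1) _ _ (@open 'rV[R]_n.+1)) => // _ [ O oO <-]; rewrite setTI.
have -> : @row_cons n @^-1` O =
    \bigcup_q (if `[< B q `<=` O >] then @row_cons n @^-1` B q else set0).
  apply/seteqP; split=> [z Oz|z [q _]]; last by case: asboolP => // + Bz; apply.
  have /nbhs_ballP[e /= e0 eO] : nbhs (row_cons z : 'rV[R]_n.+1) O.
    exact: open_nbhs_nbhs.
  have e2 : 0 < e / 2 by rewrite divr_gt0.
  have [r] := rat_in_itvoo e2; rewrite in_itv /= => /andP[r0 re].
  have /choice[q hq] : forall j : 'I_n.+1, exists q : rat,
      ball (row_cons z ord0 j : R) (ratr r) (ratr q).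
    move=> j; have [|q qj] := @rat_in_itvoo R (row_cons z ord0 j - ratr r)
      (row_cons z ord0 j + ratr r); first by rewrite ltrD2l gtrN.
    by exists q; rewrite ball_itv.
  have zq : ball (row_cons z : 'rV[R]_n.+1) (ratr r) (map_mx ratr (\row_j q j)).
    by split=> // i j; rewrite [i]ord1 [X in ball _ _ X]mxE mxE; exact: hq.
  exists (\row_j q j, r) => //; rewrite asboolT; first exact: ball_sym.
  move=> y /= yq; apply: eO; have := ball_triangle zq yq.
  by apply: le_ball; rewrite [leRHS](splitr e) lerD// ltW.
apply: countable_bigcupT_measurable => [|q]; first exact: countableP.
by case: ifP.
Qed.

End Borel.

Section Lebesgue.
Context (R : realType).

(* Lebesgue measure on the Borel sets of R^n, as an iterated product:
   R^(n+1) is identified with R^n * R, and R^0 is a point of mass 1. *)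
Fixpoint lebesgue_rV n : set (borel 'rV[R]_n) -> \bar R :=
  match n with
  | 0 => \d_(0 : borel 'rV[R]_0)
  | n'.+1 => pushforward (@lebesgue_rV n' \x lebesgue_measure)%E (@row_cons R n')
  end.
Arguments lebesgue_rV : clear implicits.

Let lebesgue_rV_measure n :
  exists m : {measure set (borel 'rV[R]_n) -> \bar R}, lebesgue_rV n = m.
Proof.
elim: n => [|n [m /= ->]]; first by exists (\d_(0 : borel 'rV[R]_0)).
by exists (measure_function_pushforward__canonical__measure_function_Measure
  (m \x lebesgue_measure)%E (@measurable_row_cons R n)).
Qed.

Let lebesgue_rV0 n : lebesgue_rV n set0 = 0%E.
Proof. by have [m ->] := lebesgue_rV_measure n; exact: measure0. Qed.
Let lebesgue_rV_ge0 n A : (0 <= lebesgue_rV n A)%E.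
Proof. by have [m ->] := lebesgue_rV_measure n; exact: measure_ge0. Qed.
Let lebesgue_rV_sigma_additive n : semi_sigma_additive (lebesgue_rV n).
Proof.
by have [m ->] := lebesgue_rV_measure n; exact: measure_semi_sigma_additive.
Qed.

HB.instance Definition _ n := isMeasure.Build _ _ _ (lebesgue_rV n)
  (lebesgue_rV0 n) (@lebesgue_rV_ge0 n) (@lebesgue_rV_sigma_additive n).

Definition bounded_domain n (D : set 'rV[R]_n) :=
  [/\ D !=set0, open D, connected D & bounded_set D].

Lemma bounded_domain_measurable n (D : set 'rV[R]_n) :
  bounded_domain D -> measurable (D : set (borel 'rV[R]_n)).
Proof. by case=> _ oD _ _; exact: open_borel. Qed.

(* Lebesgue measure on [D], as a measure on the whole space vanishing outside
   [D]: values of functions outside [D] are irrelevant in [L2 (lebesgue_on _)]. *)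
Definition lebesgue_on n (D : set 'rV[R]_n) (hD : bounded_domain D) :
    {measure set (borel 'rV[R]_n) -> \bar R} :=
  mrestr (lebesgue_rV n) (bounded_domain_measurable hD).

(* The class [v] is that of a function which is continuous on the open set [D];
   nothing is assumed about [f] outside [D] or near the boundary. *)
Definition continuous_repr n (D : set 'rV[R]_n) (hD : bounded_domain D)
    (v : L2 (lebesgue_on hD)) (f : 'rV[R]_n -> R) :=
  {in D, continuous f} /\ {ae lebesgue_on hD, forall x, L2_fun v x = f x}.

End Lebesgue.

Definition separable (T : topologicalType) :=
  exists2 S : set T, countable S & dense S.

Section DeepONet.
Context (R : realType).

(* The norm of ['rV[R]_n] in the library is the maximum norm. *)
Definition l2norm n (v : 'rV[R]_n) : R := Num.sqrt (\sum_i v ord0 i ^+ 2).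

Definition relu n (v : 'rV[R]_n) : 'rV[R]_n := map_mx (Num.max 0) v.

(* Affine maps alternating with the componentwise activation [relu]; no
   activation after the last affine map. Vectors are rows, so weights act on
   the right. *)
Inductive relu_net : forall m n, ('rV[R]_m -> 'rV[R]_n) -> Prop :=
| relu_net_affine m n (W : 'M[R]_(m, n)) (b : 'rV[R]_n) :
    relu_net (fun x => x *m W + b)
| relu_net_layer m k n (W : 'M[R]_(m, k)) (b : 'rV[R]_k)
    (f : 'rV[R]_k -> 'rV[R]_n) :
    relu_net f -> relu_net (fun x => f (relu (x *m W + b))).

(* sup of nW (F u - F v) / nV (u - v) ^ alpha over u != v in S, possibly +oo.
   The maximum with 0 makes it 0, not -oo, when S has at most one point. *)
Definition holder_const (V W : zmodType) (nV : V -> R) (nW : W -> R)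
    (alpha : R) (S : set V) (F : V -> W) : \bar R :=
  maxe 0%E (ereal_sup [set r | exists u v, [/\ S u, S v, u != v &
    r = (nW (F u - F v) / nV (u - v) `^ alpha)%:E]]).

Definition lip_const (V W : zmodType) (nV : V -> R) (nW : W -> R) (F : V -> W) :=
  holder_const nV nW 1 setT F.

Definition rms d (T : measurableType d) (mu : set T -> \bar R) (f : T -> R) : \bar R :=
  ((\int[mu]_x (f x ^+ 2)%:E) `^ 2^-1)%E.

Definition reconstruction (H : lmodType R) p (tau : 'I_p.+1 -> H)
    (a : 'rV[R]_p) : H :=
  tau ord0 + \sum_(k < p) a ord0 k *: tau (lift ord0 k).

End DeepONet.

(* Main.v *)
(* With w = iY (G u) and w' = iY (G (Dec (E u))), the triangle inequality gives
     |w - Rec (N_A (E u))|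
       <= |Rec (P w) - Rec (P w')| + |Rec (N_A (E u)) - Rec (P w')|
          + |Rec (P w) - w|,
   and Minkowski's inequality separates the three terms. The first one is at
   most Lip_RP * Lip_G * |Dec (E u) - u| ^ alpha for u in A, and Jensen's
   inequality brings the exponent alpha outside the root mean square. The
   bounds stay meaningful for infinite constants because 0 * +oo = 0.
   The Lebesgue integral is subadditive on measurable functions only; the norm
   of a difference of two Borel maps is measurable as soon as one of them
   factors continuously through a separable space, here X, Y or R^p. *)

Require Import Defs.
From mathcomp Require Import all_boot all_order all_algebra.
From mathcomp Require Import all_classical all_reals all_analysis.
From mathcomp Require Import measurable_realfun.
Import Order.TTheory GRing.Theory Num.Theory.
Import numFieldNormedType.Exports.
Set Implicit Arguments.
Unset Strict Implicit.
Unset Printing Implicit Defensive.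

Local Open Scope classical_set_scope.
Local Open Scope ring_scope.

(** * Root mean squares as L^2 norms with values in the extended reals *)

Section Rms.
Context d (T : measurableType d) (R : realType).
Variable mu : {measure set T -> \bar R}.
Implicit Types f g : T -> R.

Lemma rms_Lnorm f : rms mu f = ('N[mu]_2%:E [EFin \o f])%E.
Proof.
rewrite /rms unlock; congr (_ `^ _)%E; apply: eq_integral => x _ /=.
by rewrite powR_mulrn// real_normK// num_real.
Qed.

Lemma rms_ge0 f : (0 <= rms mu f)%E.
Proof. exact: poweR_ge0. Qed.

Lemma rmsD f g : measurable_fun setT f -> measurable_fun setT g ->
  (rms mu (fun t => (f t + g t)%R) <= rms mu f + rms mu g)%E.
Proof.
by move=> mf mg; rewrite !rms_Lnorm; apply: minkowski_EFin => //; rewrite ler1n.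
Qed.

Lemma measurable_EFin_sqr f : measurable_fun setT f ->
  measurable_fun setT (fun t => (f t ^+ 2)%:E : \bar R).
Proof. by move=> mf; apply/measurable_EFinP; exact: measurable_funX. Qed.

Lemma ae_le_rms f g : measurable_fun setT f -> measurable_fun setT g ->
  (forall t, 0 <= f t) -> {ae mu, forall t, f t <= g t} ->
  (rms mu f <= rms mu g)%E.
Proof.
move=> mf mg f0 fg; apply: gt0_ler_poweR; rewrite ?invr_ge0//.
- by rewrite in_itv/= leey andbT integral_ge0// => t _; rewrite lee_fin sqr_ge0.
- by rewrite in_itv/= leey andbT integral_ge0// => t _; rewrite lee_fin sqr_ge0.
apply: ae_ge0_le_integral => //.
- by move=> t _; rewrite lee_fin sqr_ge0.
- exact: measurable_EFin_sqr.
- by move=> t _; rewrite lee_fin sqr_ge0.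
- exact: measurable_EFin_sqr.
by apply: filterS fg => t fg _; rewrite lee_fin ler_sqr ?nnegrE// (le_trans (f0 t)).
Qed.

Lemma rmsZ c f : 0 <= c -> measurable_fun setT f ->
  rms mu (fun t => c * f t) = (c%:E * rms mu f)%E.
Proof.
move=> c0 mf; rewrite /rms.
under eq_integral do rewrite exprMn EFinM.
have f20 t : (0 <= (f t ^+ 2)%:E)%E by rewrite lee_fin sqr_ge0.
rewrite ge0_integralZl_EFin ?sqr_ge0//; last exact: measurable_EFin_sqr.
rewrite poweRM ?lee_fin ?sqr_ge0 ?integral_ge0//.
by congr (_ * _)%E; rewrite poweR_EFin -powR_mulrn// -powRrM mulfV ?powRr1//.
Qed.

Lemma rms_eq0 f : measurable_fun setT f -> rms mu f = 0%E ->
  {ae mu, forall t, f t = 0}.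
Proof.
move=> mf; rewrite rms_Lnorm => /Lnorm_eq0_eq0 f0.
have mf' : measurable_fun setT (EFin \o f) by apply/measurable_EFinP.
by apply: filterS (f0 mf' _) => [t /(_ I)[]|]; rewrite ?lte_fin.
Qed.

Lemma ae_rms0 f : measurable_fun setT f -> {ae mu, forall t, f t = 0} ->
  rms mu f = 0%E.
Proof.
move=> mf f0; apply/eqP; rewrite eq_le rms_ge0 andbT.
(* The bound 0 is the root mean square of [0 * f], also when [rms mu f] is infinite; passing to the
   absolute value of [f] then makes monotonicity applicable. *)
rewrite -[leRHS](mul0e (rms mu f)) -rmsZ//.
have -> : rms mu f = rms mu (fun t => `|f t|).
  by rewrite /rms; under [in RHS]eq_integral do rewrite real_normK ?num_real//.
apply: ae_le_rms => //; [exact: measurableT_comp|exact: measurable_funM|].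
by apply: filterS f0 => t ->; rewrite normr0 mulr0.
Qed.

(* With [0 * +oo = 0] the case [C = +oo] is meaningful: [f] then vanishes
   wherever [g] does. *)
Lemma ae_le_rmsZ (C : \bar R) f g :
  measurable_fun setT f -> measurable_fun setT g ->
  (forall t, 0 <= f t) -> (forall t, 0 <= g t) -> (0 <= C)%E ->
  {ae mu, forall t, ((f t)%:E <= C * (g t)%:E)%E} ->
  (rms mu f <= C * rms mu g)%E.
Proof.
move=> mf mg f0 g0; case: C => [c| |//] C0 fg.
  rewrite -rmsZ//; apply: ae_le_rms => //; exact: measurable_funM.
have [rg0|rg0] := eqVneq (rms mu g) 0%E; last first.
  by rewrite gt0_mulye ?leey// lt0e rg0 rms_ge0.
rewrite rg0 mule0 ae_rms0//.
apply: filterS2 fg (rms_eq0 mg rg0) => t + gt0.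
by rewrite gt0 mule0 lee_fin => ft0; apply/eqP; rewrite eq_le ft0 f0.
Qed.

End Rms.

Lemma rms_pushforward d1 d2 (S : measurableType d1) (T : measurableType d2)
    (R : realType) (mu : {measure set S -> \bar R}) (h : S -> T) (f : T -> R) :
  measurable_fun setT h -> measurable_fun setT f ->
  rms (pushforward mu h) f = rms mu (f \o h).
Proof.
move=> mh mf; rewrite /rms ge0_integral_pushforward//.
  exact: measurable_EFin_sqr.
by move=> t _; rewrite lee_fin sqr_ge0.
Qed.

(* Hoelder's inequality against the constant 1, with exponent [alpha^-1]. *)
Lemma rms_powR d (T : measurableType d) (R : realType) (mu : probability T R)
    (alpha : R) (f : T -> R) :
  0 < alpha -> alpha <= 1 -> measurable_fun setT f -> (forall t, 0 <= f t) ->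
  (rms mu (fun t => f t `^ alpha)%R <= rms mu f `^ alpha)%E.
Proof.
(* At [alpha = 1] the conjugate exponent [(1 - alpha)^-1] degenerates to [0^-1 = 0], hence the
   separate case. *)
move=> a0; rewrite le_eqVlt => /predU1P[-> mf f0|a1 mf f0].
  rewrite poweRe1 ?rms_ge0// (_ : (fun _ => _) = f)//.
  by apply/funext => t; rewrite powRr1.
pose g t := f t `^ (2 * alpha).
have mg : measurable_fun setT g.
  exact: (@measurableT_comp _ _ _ _ _ _ (@powR R ^~ (2 * alpha))).
have q0 : 0 < (1 - alpha)^-1 by rewrite invr_gt0 subr_gt0.
have := @hoelder _ _ _ mu g (cst 1) alpha^-1 (1 - alpha)^-1 mg
  (measurable_cst _).
rewrite invr_gt0 !invrK subrKC => /(_ a0 q0 erefl).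
(* The constant 1 has norm 1 because [mu] is a probability. *)
rewrite [X in (_ <= _ * X)%E](_ : _ = 1%E); last first.
  rewrite (_ : EFin \o _ = cst 1%E)// Lnorm_cst1.
  rewrite -[RHS](poweR1r (1 - alpha)^-1^-1); congr (_ `^ _)%E.
  exact: probability_setT.
rewrite mule1 Lnorm1 unlock invrK => H.
rewrite /rms poweRAC; apply: gt0_ler_poweR; rewrite ?invr_ge0//.
- by rewrite in_itv/= leey andbT integral_ge0// => t _; rewrite lee_fin sqr_ge0.
- by rewrite in_itv/= leey andbT poweR_ge0.
move: H; congr (_ <= _ `^ _)%E; apply: eq_integral => t _ /=.
  by rewrite mulr1 ger0_norm ?powR_ge0// -powR_mulrn ?powR_ge0// -powRrM mulrC.
by rewrite ger0_norm ?powR_ge0// -powRrM mulfK ?gt_eqF// powR_mulrn.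
Qed.

(** * Borel measurability of continuous maps and of norms of differences *)

Section BorelMaps.
Context (R : realType).

Lemma continuous_measurable_borel (V W : normedModType R) (f : V -> W) :
  continuous f -> measurable_fun setT (f : borel V -> borel W).
Proof.
move=> cf; apply: (@measurability _ _ (borel V) (borel W) _ _ (@open W)) => //.
by move=> _ [ O oO <-]; rewrite setTI; apply: open_borel; exact: open_comp.
Qed.

Lemma continuous_measurable_real (V : normedModType R) (f : V -> R) :
  continuous f -> measurable_fun setT (f : borel V -> R).
Proof.
move=> cf; apply: (measurability _ (RGenInftyO.measurableE R)) => //.
move=> _ [_ [x ->] <-]; rewrite setTI; apply: open_borel.
by apply: open_comp => //; exact: interval_open.
Qed.

(* [|h x - y|] is the infimum of [|h x - h v| + |y - h v|] for [v] in a countable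
   dense set. *)
Lemma measurable_norm_sub d (T : measurableType d) (V W : normedModType R)
    (h : V -> W) (f : T -> borel V) (g : T -> borel W) :
  separable V -> continuous h ->
  measurable_fun setT f -> measurable_fun setT g ->
  measurable_fun setT (fun t => `|h (f t) - (g t : W)|).
Proof.
move=> [S cS dS] ch mf mg.
have mN (v : V) : measurable_fun setT (fun t => `|h (f t) - h v| + `|(g t : W) - h v|).
  have ch' : continuous (fun x => `|h x - h v|).
    by move=> x; apply: cvg_norm; apply: cvgB; [exact: ch|exact: cvg_cst].
  have cg' : continuous (fun w : W => `|w - h v|).
    by move=> x; apply: cvg_norm; apply: cvgB; [exact: cvg_id|exact: cvg_cst].
  apply: measurable_funD.
    exact: (measurableT_comp (continuous_measurable_real ch') mf).
  exact: (measurableT_comp (continuous_measurable_real cg') mg).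
apply: (measurability _ (RGenInftyO.measurableE R)) => //.
move=> _ [_ [r ->] <-]; rewrite setTI.
rewrite (_ : _ @^-1` _ = \bigcup_(v in S)
    ((fun t => `|h (f t) - h v| + `|(g t : W) - h v|) @^-1` `]-oo, r[)).
  rewrite bigcup_set_type; apply: countable_bigcupT_measurable => [|v].
    by rewrite (eq_countable (card_setT _)).
  by rewrite -[_ @^-1` _]setTI; exact: mN.
apply/seteqP; split=> [t|t [v _]]; rewrite /= !in_itv/=; last first.
  by apply: le_lt_trans; rewrite (distrC (g t : W)); exact: ler_distD.
(* Half of the gap suffices: by the triangle inequality the sum at [v] exceeds [|h (f t) - g t|] by
   at most [2 * |h (f t) - h v|]. *)
move=> tr; pose e := (r - `|h (f t) - (g t : W)|) / 2.
have e0 : 0 < e by rewrite divr_gt0// subr_gt0.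
have : nbhs (f t : V) (h @^-1` ball (h (f t)) e).
  by apply: ch; exact: nbhsx_ballx.
rewrite nbhsE => -[ O [oO Ot] Oe].
have [v [Ov Sv]] := dS O (ex_intro _ _ Ot) oO.
exists v => //; rewrite /= in_itv/=.
have := Oe _ Ov; rewrite -ball_normE /ball_ /= => hv.
rewrite (le_lt_trans (lerD (lexx _) (ler_distD (h (f t)) _ _)))//.
rewrite (distrC (g t : W)) addrCA -mulr2n -ltrBrDl.
by rewrite -mulr_natr -ltr_pdivlMr.
Qed.

End BorelMaps.

(** * Separability of R^n, continuity of networks and reconstructions, the Euclidean norm *)

Section RowVectors.
Context (R : realType).

(** A ball of the maximum norm is a product of intervals, so rational approximations can be chosen
    coordinate by coordinate. *)
Lemma separable_rV n : separable 'rV[R]_n.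
Proof.
exists (range (map_mx ratr : 'rV[rat]_n -> 'rV[R]_n)).
  exact: sub_countable (card_image_le _ _) (countableP _).
move=> O [v Ov] oO.
have /nbhs_ballP[e /= e0 eO] : nbhs v O by exact: open_nbhs_nbhs.
have /choice[q hq] : forall j : 'I_n, exists q : rat, ball (v ord0 j) e (ratr q).
  move=> j; have [|q qj] := @rat_in_itvoo R (v ord0 j - e) (v ord0 j + e).
    by rewrite ltrD2l gtrN.
  by exists q; rewrite ball_itv.
exists (map_mx ratr (\row_j q j)); split; last by exists (\row_j q j).
by apply: eO; split=> // i j; rewrite [i]ord1 !mxE; exact: hq.
Qed.

Lemma continuous_mx (T : topologicalType) m n (f : T -> 'M[R]_(m, n)) :
  (forall i j, continuous (fun t => f t i j)) -> continuous f.
Proof.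
move=> cf t; apply/cvg_ballP => e e0.
have : \forall s \near t, forall i, forall j, ball (f t i j) e (f s i j).
  apply: filter_forall => i; apply: filter_forall => j.
  by have /cvg_ballP := cf i j t; exact.
by apply: filterS => s h; split.
Qed.

Lemma continuous_affine m n (W : 'M[R]_(m, n)) (b : 'rV[R]_n) :
  continuous (fun x : 'rV[R]_m => x *m W + b).
Proof.
apply: continuous_mx => i j x.
rewrite (_ : (fun _ => _) = fun x : 'rV[R]_m => \sum_k x i k * W k j + b i j); last first.
  by apply/funext => y; rewrite !mxE.
apply: continuousD; last exact: cst_continuous.
apply: continuous_big => [z|k _ y]; first exact: add_continuous.
by apply: continuousM; [exact: coord_continuous|exact: cst_continuous].
Qed.

Lemma continuous_relu n : continuous (@relu R n).
Proof.
apply: continuous_mx => i j x.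
rewrite (_ : (fun _ => _) = fun x : 'rV[R]_n => Num.max 0 (x i j)); last first.
  by apply/funext => y; rewrite !mxE.
apply: (@max_fun_continuous _ _ R (cst 0) (fun x : 'rV[R]_n => x i j)).
  exact: cst_continuous.
exact: coord_continuous.
Qed.

Lemma continuous_relu_net m n (f : 'rV[R]_m -> 'rV[R]_n) :
  relu_net f -> continuous f.
Proof.
elim=> {m n f} [m n W b|m k n W b f _ cf]; first exact: continuous_affine.
have cr : continuous (@relu R k \o (fun x => x *m W + b)).
  move=> x; apply: continuous_comp; last exact: continuous_relu.
  exact: continuous_affine.
by move=> x; exact: continuous_comp (cr x) (cf _).
Qed.

(** This lets the reconstruction serve as [h] in [measurable_norm_sub], with the countable dense set
    taken in R^p. *)
Lemma continuous_reconstruction (H : normedModType R) p (tau : 'I_p.+1 -> H) :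
  continuous (reconstruction tau : 'rV[R]_p -> H).
Proof.
move=> a; apply: continuousD; first exact: cst_continuous.
apply: continuous_big => [z|k _ b]; first exact: add_continuous.
exact: (cvgZr_tmp (@coord_continuous R 1 p ord0 k b)).
Qed.

Lemma l2norm_ge0 n (v : 'rV[R]_n) : 0 <= l2norm v.
Proof. exact: sqrtr_ge0. Qed.

Lemma l2norm_eq0 n (v : 'rV[R]_n) : l2norm v = 0 -> v = 0.
Proof.
move=> /eqP; rewrite sqrtr_eq0 => v0.
have s0 : \sum_i v ord0 i ^+ 2 == 0.
  by rewrite eq_le v0 sumr_ge0// => i _; exact: sqr_ge0.
apply/rowP => j; rewrite mxE; apply/eqP; rewrite -sqrf_eq0.
by move: s0; rewrite psumr_eq0 => [/allP|i _]; [apply; rewrite mem_index_enum|exact: sqr_ge0].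
Qed.

(** [measurable_norm_sub] concerns the maximum norm on row vectors; for the Euclidean norm the
    argument goes through the coordinates. *)
Lemma measurable_l2norm_sub d (T : measurableType d) n
    (f g : T -> borel 'rV[R]_n) :
  measurable_fun setT f -> measurable_fun setT g ->
  measurable_fun setT (fun t => l2norm ((f t : 'rV[R]_n) - g t)).
Proof.
move=> mf mg; apply: (@measurableT_comp _ _ _ _ _ _ (@Num.sqrt R)).
  by apply: continuous_measurable_fun; exact: sqrt_continuous.
apply: measurable_sum => i; apply: measurable_funX.
rewrite (_ : (fun _ => _) = fun t => (f t : 'rV[R]_n) ord0 i - (g t : 'rV[R]_n) ord0 i); last first.
  by apply/funext => t; rewrite !mxE.
have mc := continuous_measurable_real (@coord_continuous R 1 n ord0 i).
by apply: measurable_funB; [exact: measurableT_comp mc mf|exact: measurableT_comp mc mg].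
Qed.

End RowVectors.

(** * Hölder bounds on increments, for abstract norms so as to cover [l2norm] *)

Section Hoelder.
Context (R : realType) (V W : zmodType) (nV : V -> R) (nW : W -> R).
Hypotheses (nV_ge0 : forall v, 0 <= nV v) (nV_eq0 : forall v, nV v = 0 -> v = 0).
Hypothesis nW0 : nW 0 = 0.

Lemma holder_const_ge0 alpha S (F : V -> W) :
  (0 <= holder_const nV nW alpha S F)%E.
Proof. by rewrite le_max lexx. Qed.

(** Off the diagonal the quotient is one of the values under the supremum, and its positive
    denominator can be cleared even against an infinite constant; on the diagonal the left side is
    0. *)
Lemma holder_constP alpha S (F : V -> W) u v : S u -> S v ->
  ((nW (F u - F v))%:E
    <= holder_const nV nW alpha S F * (nV (u - v) `^ alpha)%:E)%E.
Proof.
move=> Su Sv; have [->|uv] := eqVneq u v.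
  by rewrite subrr nW0 mule_ge0 ?holder_const_ge0// lee_fin powR_ge0.
have nuv : 0 < nV (u - v).
  rewrite lt0r nV_ge0 andbT; apply: contra uv => /eqP /nV_eq0 /eqP.
  by rewrite subr_eq0.
rewrite -lee_pdivrMr ?powR_gt0// -EFinM le_max; apply/orP; right.
by apply: ereal_sup_ubound; exists u, v.
Qed.

Lemma lip_constP (F : V -> W) u v :
  ((nW (F u - F v))%:E <= lip_const nV nW F * (nV (u - v))%:E)%E.
Proof. by have := @holder_constP 1 setT F u v I I; rewrite powRr1. Qed.

End Hoelder.

Theorem theorem3p3 (R : realType) (d n m p : nat)
  (D : set 'rV[R]_d) (U : set 'rV[R]_n)
  (hD : bounded_domain D) (hU : bounded_domain U)
  (X Y : completeNormedModType R) (sepX : separable X) (sepY : separable Y)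
  (iX : {linear X -> L2 (lebesgue_on hD)})
  (iX_inj : injective iX) (iX_cont : continuous iX)
  (iY : {linear Y -> L2 (lebesgue_on hU)})
  (iY_inj : injective iY) (iY_cont : continuous iY)
  (mu : probability (borel X) R)
  (mu_moment2 : (\int[mu]_u (`|(u : X)| ^+ 2)%:E < +oo)%E)
  (A : set X) (mA : measurable (A : set (borel X)))
  (A_continuous : forall u, A u -> exists f, continuous_repr (iX u) f)
  (muA : mu A = 1%E)
  (G : borel X -> borel Y) (mG : measurable_fun setT G)
  (G_moment2 : (\int[mu]_u (`|iY (G u)| ^+ 2)%:E < +oo)%E)
  (alpha : R) (alpha_gt0 : 0 < alpha) (alpha_le1 : alpha <= 1)
  (G_holder : (@holder_const R X Y Num.norm Num.norm alpha A G < +oo)%E)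
  (x : 'I_m -> 'rV[R]_d) (xD : forall j, D (x j))
  (E : borel X -> borel 'rV[R]_m) (mE : measurable_fun setT E)
  (E_eval : forall u f, continuous_repr (iX u) f -> E u = \row_j f (x j))
  (N_A : 'rV[R]_m -> 'rV[R]_p) (relu_A : relu_net N_A)
  (trunk : 'rV[R]_n -> 'rV[R]_p.+1) (relu_trunk : relu_net trunk)
  (tau : 'I_p.+1 -> L2 (lebesgue_on hU))
  (tau_trunk : forall k,
     {ae lebesgue_on hU, forall y, L2_fun (tau k) y = trunk y ord0 k})
  (Dec : borel 'rV[R]_m -> borel X) (mDec : measurable_fun setT Dec)
  (DecK : forall v, E (Dec v) = v)
  (P : borel (L2 (lebesgue_on hU)) -> borel 'rV[R]_p)
  (mP : measurable_fun setT P)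
  (PK : forall a, P (reconstruction tau a) = a) :
  let Rec := reconstruction tau in
  let err := rms mu (fun u => `|iY (G u) - Rec (N_A (E u))|) in
  let err_E := rms mu (fun u => `|(Dec (E u) : X) - u|) in
  let err_A := rms (pushforward mu E)
    (fun v => l2norm (N_A v - P (iY (G (Dec v))))) in
  let err_R := rms (pushforward mu (fun u => iY (G u) : borel (L2 (lebesgue_on hU))))
    (fun w => `|Rec (P w) - w|) in
  (* [iY \o G] because [P] and [Rec] only see the values of [G] in L^2(U); the
     decoder is not assumed to take its values in [A]. When it does, the set
     below is [A]. *)
  let Lip_G := @holder_const R X (L2 (lebesgue_on hU)) Num.norm Num.norm alpha
    (A `|` range Dec) (fun u => iY (G u)) in
  let Lip_RP := @lip_const R _ (L2 (lebesgue_on hU)) Num.norm Num.norm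
    (fun w => Rec (P w)) in
  let Lip_R := lip_const (@l2norm R p) Num.norm Rec in
  (err <= Lip_G * Lip_RP * err_E `^ alpha + Lip_R * err_A + err_R)%E.
Proof.
cbv zeta; set Rec := reconstruction tau.
set err := (X in (X <= _)%E); set Lip_G := (X in (X * _ * _)%E).
set Lip_RP := (X in (_ * X * _)%E); set err_E := (X in (_ * _ * X `^ _)%E).
set Lip_R := (X in (_ + X * _ + _)%E); set err_A := (X in (_ + _ * X + _)%E).
set err_R := (X in (_ + _ + X)%E).
have cRec : continuous (Rec : 'rV[R]_p -> L2 (lebesgue_on hU)).
  exact: continuous_reconstruction.
have mRec := continuous_measurable_borel cRec.
have mN := continuous_measurable_borel (continuous_relu_net relu_A).
have mNE := measurableT_comp mN mE.
have mw := measurableT_comp (continuous_measurable_borel iY_cont) mG.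
have mPw := measurableT_comp mP mw.
have mDE := measurableT_comp mDec mE.
pose f1 u := `|Rec (P (iY (G u))) - Rec (P (iY (G (Dec (E u)))))|.
pose f2 u := `|Rec (N_A (E u)) - Rec (P (iY (G (Dec (E u)))))|.
pose f3 u := `|Rec (P (iY (G u))) - iY (G u)|.
pose e u := `|(Dec (E u) : X) - u|.
have mRPwDE := measurableT_comp mRec (measurableT_comp mPw mDE).
have mf1 : measurable_fun setT f1.
  exact: (measurable_norm_sub (@separable_rV R p) cRec mPw mRPwDE).
have mf2 : measurable_fun setT f2.
  exact: (measurable_norm_sub (@separable_rV R p) cRec mNE mRPwDE).
have mf3 : measurable_fun setT f3.
  exact: (measurable_norm_sub (@separable_rV R p) cRec mPw mw).
(* Here [h] is the identity of the separable space [X]. *)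
have me : measurable_fun setT e.
  exact: (@measurable_norm_sub R _ _ X X idfun _ _ sepX (fun x => cvg_id)
    mDE (@measurable_id _ _ setT)).
have mf12 : measurable_fun setT (fun u => f1 u + f2 u) by exact: measurable_funD.
have err123 : (err <= rms mu f1 + rms mu f2 + rms mu f3)%E.
  apply: le_trans (leeD (rmsD mu mf1 mf2) (lexx _)).
  apply: le_trans (rmsD mu mf12 mf3).
  apply: ae_le_rms => //.
  - exact: (measurable_norm_sub sepY iY_cont mG (measurableT_comp mRec mNE)).
  - exact: measurable_funD.
  (* With [f3] in front, the distance is split first at [Rec (P (iY (G u)))], then at
     [Rec (P (iY (G (Dec (E u)))))]. *)
  apply: aeW => u; rewrite [leRHS]addrC /=.
  rewrite (le_trans (ler_distD (Rec (P (iY (G u)))) _ _))//.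
  rewrite (distrC (iY (G u))) lerD//.
  rewrite (le_trans (ler_distD (Rec (P (iY (G (Dec (E u)))))) _ _))//.
  by rewrite lerD// distrC.
apply: le_trans err123 _; apply: leeD; first apply: leeD.
- have LG0 : (0 <= Lip_G)%E by exact: holder_const_ge0.
  have LRP0 : (0 <= Lip_RP)%E by exact: holder_const_ge0.
  have mea : measurable_fun setT (fun u => e u `^ alpha).
    exact: (@measurableT_comp _ _ _ _ _ _ (@powR R ^~ alpha)).
  apply: (@le_trans _ _ (Lip_G * Lip_RP * rms mu (fun u => e u `^ alpha)%R)%E); last first.
    apply: lee_wpmul2l; [exact: mule_ge0|].
    exact: (rms_powR mu alpha_gt0 alpha_le1 me (fun u => normr_ge0 _)).
  apply: ae_le_rmsZ => // [u|u||]; [exact: normr_ge0|exact: powR_ge0|exact: mule_ge0|].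
  (* The pointwise bound is proved for [u] in [A] only, where [Lip_G] controls the increment; the
     exceptional set is null. *)
  have muAC : mu (~` A) = 0%E.
    by have := probability_setC mu mA; rewrite muA subee.
  exists (~` A); split=> //; first exact: measurableC.
  apply: subsetC => u Au /=.
  pose LP := lip_constP (@normr_ge0 _ _) (@normr0_eq0 _ _) (normr0 _)
    (fun w => Rec (P w)) (iY (G u)) (iY (G (Dec (E u)))).
  apply: le_trans LP _.
  rewrite -muleA muleCA; apply: lee_wpmul2l => //.
  (* The points are now [Dec (E u)], in the range of the decoder, and [u], in [A]: both lie in the
     set defining [Lip_G]. *)
  rewrite distrC; apply: holder_constP => [v|v|||].
  + exact: normr_ge0.
  + exact: normr0_eq0.
  + exact: normr0.
  + by right; exists (E u).
  + by left.
- have mN_P : measurable_fun setT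
      (fun v : borel 'rV[R]_m => l2norm ((N_A v : 'rV[R]_p) - P (iY (G (Dec v))))).
    exact: (measurable_l2norm_sub mN (measurableT_comp mPw mDec)).
  (* Once [err_A] is an integral against [mu], the Lipschitz bound on [f2] holds at every [u]. *)
  rewrite /err_A rms_pushforward//.
  apply: ae_le_rmsZ => // [|u|u||].
  + exact: measurableT_comp mN_P mE.
  + exact: normr_ge0.
  + exact: l2norm_ge0.
  + exact: holder_const_ge0.
  apply: aeW => u; apply: lip_constP => [v|v|]; rewrite ?normr0//.
  + exact: l2norm_ge0.
  + exact: l2norm_eq0.
(* The change of variables turns [err_R] into [rms mu f3] exactly; only measurability of its
   integrand on L^2(U) remains. *)
- rewrite /err_R rms_pushforward//.
  exact: (measurable_norm_sub (@separable_rV R p) cRec mP (@measurable_id _ _ setT)).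
Qed.
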